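(* Let $G$ be a Garside group of finite type with a fixed finite type Garside structure $(G,P,\Delta)$. Let $x\in G$ be a super summit element (that is, $x\in\mathrm{SSS}(x)$) which has a rigid conjugate. Then iterated cyclic sliding conjugates $x$ to a rigid element, and the obtained conjugating element is the minimal positive element doing so. Precisely: there exists an integer $k\ge 0$ such that $\mathfrak s^k(x)$ is rigid, and for such $k$ the positive element $\mathfrak P_k(x)=\mathfrak p(x)\,\mathfrak p(\mathfrak s(x))\cdots\mathfrak p(\mathfrak s^{k-1}(x))$, which satisfies $x^{\mathfrak P_k(x)}=\mathfrak s^k(x)$, has the property that $\mathfrak P_k(x)\preccurlyeq\alpha$ for every $\alpha\in P$ such that $x^{\alpha}$ is rigid.
   Context: Garside structure: a group $G$ with a submonoid $P$ (the positive elements), $P\cap P^{-1}=\{1\}$, and an element $\Delta\in P$ such that: (G1) the partial order $a\preccurlyeq b \Leftrightarrow a^{-1}b\in P$ on $G$ is a lattice order, with greatest common divisor $a\wedge b$ and least common multiple $a\vee b$; (G2) the set $[1,\Delta]=\{a\in G\mid 1\preccurlyeq a\preccurlyeq\Delta\}$ of simple elements generates $G$; (G3) $\Delta^{-1}P\Delta=P$; (G4) for every $x\in P\setminus\{1\}$, $\|x\|=\sup\{k\mid \exists a_1,\dots,a_k\in P\setminus\{1\},\ x=a_1\cdots a_k\}<\infty$. It is of finite type if $[1,\Delta]$ is finite. Notation: $x^{\alpha}=\alpha^{-1}x\alpha$; $x^G$ is the conjugacy class of $x$. $\inf(x)$ is the maximal integer $p$ with $\Delta^p\preccurlyeq x$,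 $\sup(x)$ is the minimal integer $q$ with $x\preccurlyeq\Delta^q$, and $\ell(x)=\sup(x)-\inf(x)$ is the canonical length. The super summit set $\mathrm{SSS}(x)$ is the set of $y\in x^G$ for which $\ell(y)$ is minimal on $x^G$ (equivalently, $\inf(y)$ is maximal and $\sup(y)$ is minimal on $x^G$). Preferred prefix: $\mathfrak p(x)=(x\Delta^{-\inf(x)})\wedge(x^{-1}\Delta^{\sup(x)})\wedge\Delta$. Cyclic sliding: $\mathfrak s(x)=x^{\mathfrak p(x)}=\mathfrak p(x)^{-1}x\,\mathfrak p(x)$. An element $x$ is rigid if $\mathfrak p(x)=1$. By convention $\mathfrak P_0(x)=1$. *)

(* Defs.v *)
From mathcomp Require Import all_boot all_order ssralg ssrnum ssrint.
From mathcomp Require Import boolp classical_sets functions cardinality.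

Set Implicit Arguments.
Unset Strict Implicit.
Unset Printing Implicit Defensive.

Local Open Scope classical_set_scope.
Local Open Scope group_scope.

(* Groups are [groupType]s (not assumed finite); [x ^ a] is a^-1 * (x * a). *)

Definition expgz (G : groupType) (x : G) (n : int) : G :=
  match n with Posz m => x ^+ m | Negz m => x ^- m.+1 end.

Definition submonoid_set (G : groupType) (M : set G) : Prop :=
  M 1 /\ (forall a b, M a -> M b -> M (a * b)).

Definition subgroup_set (G : groupType) (H : set G) : Prop :=
  submonoid_set H /\ (forall a, H a -> H a^-1).

Definition conj_class (G : groupType) (x : G) : set G :=
  [set x ^ a | a in [set: G]].

Definition prefix_le (G : groupType) (P : set G) (a b : G) : Prop :=
  P (a^-1 * b).

(* The fields [gcdG] and [lcmG] are no additional structure: [prefix_le P] is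
   antisymmetric when P `&` P^-1 = {1}, so they are determined by P. *)
Record garside (G : groupType) := Garside {
  pos : set G;
  delta : G;
  gcdG : G -> G -> G;
  lcmG : G -> G -> G;
  pos_submonoid : submonoid_set pos;
  pos_pointed : pos `&` [set a^-1 | a in pos] = [set 1];
  delta_pos : pos delta;
  gcdG_lel : forall a b, prefix_le pos (gcdG a b) a;
  gcdG_ler : forall a b, prefix_le pos (gcdG a b) b;
  gcdG_max : forall a b c,
    prefix_le pos c a -> prefix_le pos c b -> prefix_le pos c (gcdG a b);
  lcmG_gel : forall a b, prefix_le pos a (lcmG a b);
  lcmG_ger : forall a b, prefix_le pos b (lcmG a b);
  lcmG_min : forall a b c,
    prefix_le pos a c -> prefix_le pos b c -> prefix_le pos (lcmG a b) c;
  simple_gen :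
    smallest (@subgroup_set G)
      [set a | prefix_le pos 1 a /\ prefix_le pos a delta] = [set: G];
  pos_conj_delta : [set a ^ delta | a in pos] = pos;
  pos_norm_finite : forall x, pos x -> x <> 1 ->
    has_ubound [set k : nat | exists s : seq G,
      [/\ size s = k, forall a, a \in s -> pos a /\ a <> 1
        & x = \prod_(a <- s) a]]
}.

Definition gle (G : groupType) (S : garside G) (a b : G) : Prop :=
  prefix_le (pos S) a b.

Definition simples (G : groupType) (S : garside G) : set G :=
  [set a | gle S 1 a /\ gle S a (delta S)].

Definition finite_type (G : groupType) (S : garside G) : Prop :=
  finite_set (simples S).

(* [xget 0] picks the unique element of the set when there is one.  There is
   none only if delta = 1, in which case G is trivial; both [ginf] and [gsup]
   then take the junk value 0. *)
Definition ginf (G : groupType) (S : garside G) (x : G) : int :=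
  xget 0%R [set p : int | gle S (expgz (delta S) p) x /\
    (forall q : int, gle S (expgz (delta S) q) x -> (q <= p)%R)].

Definition gsup (G : groupType) (S : garside G) (x : G) : int :=
  xget 0%R [set q : int | gle S x (expgz (delta S) q) /\
    (forall p : int, gle S x (expgz (delta S) p) -> (q <= p)%R)].

Definition canonical_length (G : groupType) (S : garside G) (x : G) : int :=
  (gsup S x - ginf S x)%R.

Definition SSS (G : groupType) (S : garside G) (x : G) : set G :=
  [set y | conj_class x y /\ forall z, conj_class x z ->
    (canonical_length S y <= canonical_length S z)%R].

Definition preferred_prefix (G : groupType) (S : garside G) (x : G) : G :=
  gcdG S (gcdG S (x * expgz (delta S) (- ginf S x)%R)
                 (x^-1 * expgz (delta S) (gsup S x)))
         (delta S).

Definition cyclic_sliding (G : groupType) (S : garside G) (x : G) : G :=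
  x ^ preferred_prefix S x.

Definition rigid (G : groupType) (S : garside G) (x : G) : Prop :=
  preferred_prefix S x = 1.

Definition sliding_conjugator (G : groupType) (S : garside G) (k : nat)
    (x : G) : G :=
  \prod_(i < k) preferred_prefix S (iter i (cyclic_sliding S) x).

(* Main.v *)
Require Import Defs.
From mathcomp Require Import all_boot all_order ssralg ssrnum ssrint.
From mathcomp Require Import boolp classical_sets functions cardinality.
From mathcomp Require Import zify.

Local Open Scope classical_set_scope.
Local Open Scope group_scope.

(** Write [a ≼ b] for the prefix order, [p = inf], [q = sup], [pp] for the
preferred prefix, and [D n] for the powers of Delta.

The heart of the matter is that [pp x ≼ a] for every super summit [x] and
every positive [a] such that [y = x ^ a] is rigid.  If [x] and [y] have the
same [inf] and the same [sup], then [pp x ≼ a * pp y]: left multiplication by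
[a] preserves gcds, so [a * pp y] is the gcd of [a * y * D (- p)],
[a * y^-1 * D q] and [a * D 1]; since [a * y = x * a] and Delta normalizes the
positive monoid, these three are multiples of [x * D (- p)], [x^-1 * D q] and
[D 1], whose gcd is [pp x] ([preferred_prefix_transport]).  When [y] is rigid,
[pp y = 1].

That [x] and [y] do have the same [inf] and [sup] holds because a rigid element
has the greatest [inf] and the least [sup] of its conjugacy class
([rigid_ginf_max], [rigid_gsup_min]).  Rigidity makes powers of [y] behave like
concatenated normal forms, so [inf (y ^+ m)] does not exceed [m * inf y]
([rigid_expgz_ngleX]), whereas a conjugate with a larger [inf] would make
[inf (y ^+ m)] grow by at least one more for each factor, up to a bounded error.

The rest is induction.  Sliding keeps [x] super summit, and it replaces the pair
[(x, a)] by [(x ^ pp x, (pp x)^-1 * a)], with the same target [y].  Hence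
each product of successive preferred prefixes is a prefix of [a].  As long as
no rigid element is reached these prefixes are products of nontrivial positive
elements, and the norm axiom [pos_norm_finite] bounds their number. *)

Section GarsideTheory.

Set Implicit Arguments.
Unset Strict Implicit.

(** * Integer powers in a group *)

Lemma expgzS (G : groupType) (x : G) (n : int) :
  expgz x (n + 1)%R = expgz x n * x.
Proof.
case: n => [n|[|n]].
- by rewrite (_ : (Posz n + 1)%R = Posz n.+1) ?[LHS]expgSr //; lia.
- by rewrite (_ : (Negz 0 + 1)%R = Posz 0) //= expg1 mulVg.
- rewrite (_ : (Negz n.+1 + 1)%R = Negz n); last by lia.
  by rewrite /= (expgS _ n.+1) invgM mulgVK.
Qed.

Lemma expgzD (G : groupType) (x : G) (m n : int) :
  expgz x (m + n)%R = expgz x m * expgz x n.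
Proof.
elim/int_rect: n => [|n IHn|n IHn].
- by rewrite GRing.addr0 mulg1.
- have -> : (m + Posz n.+1 = m + Posz n + 1)%R by lia.
  by rewrite expgzS IHn -mulgA -expgzS; congr (_ * expgz x _); lia.
- apply: (mulIg x); rewrite -expgzS -mulgA -expgzS.
  have -> : (m - Posz n.+1 + 1 = m - Posz n)%R by lia.
  by rewrite IHn; congr (_ * expgz x _); lia.
Qed.

Lemma expgzN (G : groupType) (x : G) (n : int) :
  expgz x (- n)%R = (expgz x n)^-1.
Proof. by apply/esym/mulg1_eq; rewrite -expgzD GRing.subrr. Qed.

(** * The prefix order *)

Variables (G : groupType) (S : garside G).

Local Notation "a ≼ b" := (gle S a b) (at level 70, no associativity).
Local Notation D := (expgz (delta S)).
Local Notation P := (pos S).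

Lemma conj_expgz m n : D m ^ D n = D m.
Proof. by rewrite conjgE -expgzD GRing.addrC expgzD mulKg. Qed.

Lemma pos1 : P 1. Proof. by case: (pos_submonoid S). Qed.

Lemma posM a b : P a -> P b -> P (a * b).
Proof. by case: (pos_submonoid S) => _; apply. Qed.

Lemma pos_anti a : P a -> P a^-1 -> a = 1.
Proof.
move=> pa pVa; have : [set 1 : G] a; last by [].
by rewrite -(pos_pointed S); split=> //; exists a^-1; rewrite ?invgK.
Qed.

Lemma pos_conj_expgz n a : P (a ^ D n) = P a.
Proof.
have posJ b : P (b ^ delta S) = P b.
  apply/propext; split=> pb; last by rewrite -(pos_conj_delta S); exists b.
  by move: pb; rewrite -{1}(pos_conj_delta S) /= => -[c pc /conjg_inj <-].
have step m : P (a ^ D (m + 1)%R) = P (a ^ D m) by rewrite expgzS conjgM posJ.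
elim/int_rect: n => [|n <-|n <-].
- by rewrite conjg1.
- by rewrite -[RHS]step; congr (P (a ^ D _)); lia.
- by rewrite -step; congr (P (a ^ D _)); lia.
Qed.

Lemma pos_expgzC n a : P (D n * a) = P (a * D n).
Proof. by rewrite -(pos_conj_expgz n) conjgE -mulgA mulKg. Qed.

Lemma gle_refl a : a ≼ a.
Proof. by rewrite /gle /prefix_le mulVg; exact: pos1. Qed.

Lemma gle_trans a b c : b ≼ a -> a ≼ c -> b ≼ c.
Proof.
move=> ba ac; rewrite /gle /prefix_le -(mulgK a b^-1) -mulgA.
exact: posM.
Qed.

Lemma gle_anti a b : a ≼ b -> b ≼ a -> a = b.
Proof.
move=> ab ba; apply: invg_inj; apply: divg1_eq; rewrite invgK.
by apply: pos_anti => //; rewrite invgM invgK.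
Qed.

Lemma gle_mul2l c a b : (c * a ≼ c * b) = (a ≼ b).
Proof. by rewrite /gle /prefix_le invgM -mulgA mulKg. Qed.

Lemma gle_mul2r n a b : (a * D n ≼ b * D n) = (a ≼ b).
Proof.
rewrite /gle /prefix_le -[in RHS](pos_conj_expgz n) conjgE.
by rewrite invgM !mulgA.
Qed.

Lemma gle_conj n a b : (a ^ D n ≼ b ^ D n) = (a ≼ b).
Proof. by rewrite gle_mul2l gle_mul2r. Qed.

Lemma gle_mulr a b : (a ≼ a * b) = P b.
Proof. by rewrite /gle /prefix_le mulKg. Qed.

Lemma gle1 a : (1 ≼ a) = P a.
Proof. by rewrite /gle /prefix_le invg1 mul1g. Qed.

Lemma gle_invl n a : (D n ≼ a^-1) = (a ≼ D (- n)%R).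
Proof. by rewrite /gle /prefix_le -expgzN pos_expgzC. Qed.

Lemma pos_expgz (n : nat) : P (D n).
Proof.
elim: n => [|n IHn]; first exact: pos1.
by rewrite /= expgSr; apply: posM => //; exact: delta_pos.
Qed.

Lemma gle_expgz m n : (m <= n)%R -> D m ≼ D n.
Proof.
move=> le_mn; have -> : n = (m + `|n - m|%N)%R by lia.
by rewrite expgzD gle_mulr; exact: pos_expgz.
Qed.

Lemma expgz_gleM m n a b : D m ≼ a -> D n ≼ b -> D (m + n)%R ≼ a * b.
Proof.
move=> ma nb; apply: (@gle_trans (a * D n)).
  by rewrite expgzD gle_mul2r.
by rewrite gle_mul2l.
Qed.

Lemma gleM_expgz m n a b : a ≼ D m -> b ≼ D n -> a * b ≼ D (m + n)%R.
Proof.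
move=> am bn; apply: (@gle_trans (a * D n)); first by rewrite gle_mul2l.
by rewrite expgzD gle_mul2r.
Qed.

Lemma expgz_gleX m a k : D m ≼ a -> D (m * Posz k)%R ≼ a ^+ k.
Proof.
move=> ma; elim: k => [|k IHk]; first by rewrite GRing.mulr0; exact: gle_refl.
have -> : (m * Posz k.+1 = m + m * Posz k)%R by lia.
by rewrite expgS; exact: expgz_gleM.
Qed.

Lemma gleX_expgz n a k : a ≼ D n -> a ^+ k ≼ D (n * Posz k)%R.
Proof.
move=> an; elim: k => [|k IHk]; first by rewrite GRing.mulr0; exact: gle_refl.
have -> : (n * Posz k.+1 = n + n * Posz k)%R by lia.
by rewrite expgS; exact: gleM_expgz.
Qed.

(** The elements lying between two powers of Delta form a subgroup, and it
contains the simple elements, which generate. *)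
Lemma expgz_bounds a : exists n : nat, D (- Posz n)%R ≼ a /\ a ≼ D n.
Proof.
pose H := [set a | exists n : nat, D (- Posz n)%R ≼ a /\ a ≼ D n].
have : [set: G] a by [].
rewrite -(simple_gen S); apply: (@smallest_sub _ _ _ H).
- split; first split.
  + by exists 0%N; split; exact: gle_refl.
  + move=> b c [m [mb bm]] [n [nc cn]]; exists (m + n)%N; split.
      have -> : (- Posz (m + n) = - Posz m - Posz n)%R by lia.
      exact: expgz_gleM.
    by rewrite PoszD; exact: gleM_expgz.
  + move=> b [n [nb bn]]; exists n; rewrite gle_invl GRing.opprK; split=> //.
    by rewrite -(GRing.opprK (Posz n)) -gle_invl invgK.
- move=> b [b1 bD]; exists 1%N; split; last by [].
  apply: gle_trans b1; exact: (@gle_expgz (-1)%R 0%R).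
Qed.

Lemma gle_gcdG c a b : c ≼ gcdG S a b <-> c ≼ a /\ c ≼ b.
Proof.
split=> [cab|[]]; last exact: gcdG_max.
by split; apply: gle_trans cab _; [exact: gcdG_lel|exact: gcdG_ler].
Qed.

(** The reason why a nontrivial positive element has a nontrivial simple
prefix.  From [a ≼ D n.+1] and [a ≼ a * D n] one gets
[a ≼ (a ∧ Delta) * D n], which is [D n] here; so the exponent can be lowered
down to 0. *)
Lemma gle1_coprime_delta a : gcdG S a (delta S) = 1 -> a ≼ 1.
Proof.
move=> aD; have [n [_]] := expgz_bounds a.
elim: n => [//|n IHn] an; apply: IHn.
suff : a * D (- Posz n)%R ≼ gcdG S a (delta S).
  by rewrite aD -(gle_mul2r n) -mulgA -expgzD GRing.addNr mulg1 mul1g.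
apply/gle_gcdG; split; rewrite -(gle_mul2r n) -mulgA -expgzD GRing.addNr mulg1.
  by rewrite gle_mulr; exact: pos_expgz.
by move: an; rewrite /= expgS.
Qed.

(** The degenerate case, in which [inf] and [sup] do not exist. *)
Lemma trivial_delta : delta S = 1 -> forall a : G, a = 1.
Proof.
move=> D1; have D_1 n : D n = 1.
  by case: n => n; rewrite /= D1 expg1n ?invg1.
by move=> a; have [n []] := expgz_bounds a; rewrite !D_1 => ? ?; exact: gle_anti.
Qed.

(** * Infimum, supremum and the preferred prefix *)

Hypothesis delta_neq1 : delta S <> 1.

Lemma expgz_gle m n : (D m ≼ D n) -> (m <= n)%R.
Proof.
move=> mn; case: (boolP (m <= n)%R) => // lt_nm; case: delta_neq1.
apply: gle_anti; last by rewrite gle1; exact: delta_pos.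
rewrite -[delta S]/(D 1) -[1]/(D 0) -(gle_mul2r n) -!expgzD GRing.add0r.
by apply: gle_trans mn; apply: gle_expgz; lia.
Qed.

Lemma ginfP a : D (ginf S a) ≼ a /\ forall q, D q ≼ a -> (q <= ginf S a)%R.
Proof.
apply: (@xgetPex _ 0%R [set p : int | D p ≼ a /\
  (forall q : int, D q ≼ a -> (q <= p)%R)]).
have [n [na an]] := expgz_bounds a.
have ex : exists k : nat, `[< D (Posz k - Posz n)%R ≼ a >].
  by exists 0%N; apply/asboolP; rewrite GRing.sub0r.
(* The exponents to be maximized lie between - n and n; they are shifted by n
   so that the maximum can be taken over natural numbers. *)
have bnd k : `[< D (Posz k - Posz n)%R ≼ a >] -> k <= n + n.
  by move/asboolP=> /gle_trans /(_ an) /expgz_gle; lia.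
case: (ex_maxnP ex bnd) => k /asboolP ka kmax.
exists (Posz k - Posz n)%R; split=> // q qa.
case: (boolP (q <= - Posz n)%R) => [|nq]; first by lia.
have /kmax : `[< D (Posz (absz (q + Posz n)%R) - Posz n)%R ≼ a >]; last by lia.
by apply/asboolP; have -> : (Posz (absz (q + Posz n)%R) - Posz n = q)%R by lia.
Qed.

Lemma gsupE a : gsup S a = (- ginf S a^-1)%R.
Proof.
have [ia imax] := ginfP a^-1.
have min_sup p : a ≼ D p -> (- ginf S a^-1 <= p)%R.
  by rewrite -{1}(GRing.opprK p) -gle_invl => /imax; lia.
rewrite /gsup; apply: xget_unique => [|q [aq qmin]].
  by split=> //; rewrite -gle_invl.
have := min_sup _ aq; have : (q <= - ginf S a^-1)%R; last by lia.
by apply: qmin; rewrite -gle_invl.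
Qed.

Lemma ginfV a : ginf S a^-1 = (- gsup S a)%R.
Proof. by rewrite gsupE GRing.opprK. Qed.

Lemma gsupV a : gsup S a^-1 = (- ginf S a)%R.
Proof. by rewrite gsupE invgK. Qed.

Lemma gsupP a : a ≼ D (gsup S a) /\ forall q, a ≼ D q -> (gsup S a <= q)%R.
Proof.
rewrite gsupE -gle_invl; have [ia imax] := ginfP a^-1; split=> // q.
by rewrite -{1}(GRing.opprK q) -gle_invl => /imax; lia.
Qed.

Lemma ginf_le_gsup a : (ginf S a <= gsup S a)%R.
Proof.
by apply: expgz_gle; apply: gle_trans (gsupP a).1; exact: (ginfP a).1.
Qed.

(** Testing prefixes against the three factors of the gcd, with inverses
cleared, replaces every later computation with gcds. *)
Lemma gle_preferred_prefix c a :
  c ≼ preferred_prefix S a <->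
  [/\ c * D (ginf S a) ≼ a, a * c ≼ D (gsup S a) & c ≼ delta S].
Proof.
rewrite /preferred_prefix !gle_gcdG.
rewrite -(gle_mul2r (ginf S a) c) -mulgA -expgzD GRing.addNr mulg1.
rewrite -(gle_mul2l a c) mulVKg.
by split=> [[[]]|[]].
Qed.

Lemma preferred_prefix_pos a : P (preferred_prefix S a).
Proof.
rewrite -gle1; apply/gle_preferred_prefix; rewrite mul1g mulg1 gle1; split.
- exact: (ginfP a).1.
- exact: (gsupP a).1.
- exact: delta_pos.
Qed.

(** Inversion exchanges the first two factors of the gcd; this is what reduces
statements on [sup] to statements on [inf]. *)
Lemma preferred_prefixV a : preferred_prefix S a^-1 = preferred_prefix S a.
Proof.
have le b : preferred_prefix S b ≼ preferred_prefix S b^-1.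
  have [] := (gle_preferred_prefix _ b).1 (gle_refl _).
  move=> ib sb db; apply/gle_preferred_prefix; rewrite ginfV gsupV; split=> //.
    by rewrite -(gle_mul2r (gsup S b)) -mulgA -expgzD GRing.addNr mulg1
      -(gle_mul2l b) mulVKg.
  by rewrite -(gle_mul2l b) mulVKg -(gle_mul2r (ginf S b)) -mulgA -expgzD
    GRing.addNr mulg1.
by apply: gle_anti => //; rewrite -{2}(invgK a).
Qed.

Lemma rigidV a : rigid S a -> rigid S a^-1.
Proof. by rewrite /rigid preferred_prefixV. Qed.

Lemma ginf_conj_expgz n a : ginf S (a ^ D n) = ginf S a.
Proof.
have DgJ m : (D m ≼ a ^ D n) = (D m ≼ a) by rewrite -{1}(conj_expgz m n) gle_conj.
have [ia imax] := ginfP a; have [iJ Jmax] := ginfP (a ^ D n).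
by move: iJ ia; rewrite DgJ -(DgJ (ginf S a)) => /imax + /Jmax; lia.
Qed.

Lemma gsup_conj_expgz n a : gsup S (a ^ D n) = gsup S a.
Proof. by rewrite !gsupE -conjVg ginf_conj_expgz. Qed.

Lemma rigid_conj_expgz n a : rigid S a -> rigid S (a ^ D n).
Proof.
move=> ra; set c := preferred_prefix S (a ^ D n).
pose e := c ^ (D n)^-1; have ce : c = e ^ D n by rewrite conjgKV.
have [ic sc dc] := (gle_preferred_prefix c _).1 (gle_refl c).
have e1 : e ≼ 1.
  rewrite -ra; apply/gle_preferred_prefix; split.
  - by rewrite -(gle_conj n) conjMg -ce conj_expgz -(ginf_conj_expgz n).
  - by rewrite -(gle_conj n) conjMg -ce conj_expgz -(gsup_conj_expgz n).
  - by rewrite -(gle_conj n) -ce (conj_expgz 1%R).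
apply: gle_anti; last by rewrite gle1; exact: preferred_prefix_pos.
by rewrite -/c ce -(conj1g (D n)) gle_conj.
Qed.

(** * Rigid elements are extremal in their conjugacy class *)

(** Rigidity speaks of the simple common prefixes of [y * D (- p)] and
[y^-1 * D q].  If their gcd were nontrivial, it would have a nontrivial simple
prefix, so rigidity controls all common prefixes. *)
Lemma rigid_gle1 y c :
  rigid S y -> c * D (ginf S y) ≼ y -> y * c ≼ D (gsup S y) -> c ≼ 1.
Proof.
move=> ry ic sc; apply: gle_trans (gle1_coprime_delta ry); apply/gle_gcdG; split.
  by rewrite -(gle_mul2r (ginf S y)) -mulgA -expgzD GRing.addNr mulg1.
by rewrite -(gle_mul2l y) mulVKg.
Qed.

(** In terms of gcds: [y ^+ m.+1 * D (- p * m) ∧ D q = y], i.e. the first factors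
of the normal form of a power of [y] are those of [y].  For [m = 1] this is
rigidity, [y * D (- p) ∧ y^-1 * D q = 1], multiplied by [y] on the left.  The
inductive step multiplies the identity for [m] by [y] on the left and uses
[D q ≼ y * D (q - p)]. *)
Lemma rigid_gleX y m c :
  rigid S y -> c * D (ginf S y * Posz m)%R ≼ y ^+ m.+1 -> c ≼ D (gsup S y) ->
  c ≼ y.
Proof.
set p := ginf S y; set q := gsup S y => ry.
have [py _] : D p ≼ y /\ _ := ginfP y.
elim: m c => [|m IHm] c; first by rewrite GRing.mulr0 mulg1 expg1.
move=> cX cq; suff : y^-1 * c ≼ 1 by rewrite -(gle_mul2l y) mulVKg mulg1.
apply: (rigid_gle1 ry); rewrite -/p -/q ?mulVKg //.
apply: IHm.
  rewrite -(gle_mul2l y) -expgS -!mulgA mulVKg -expgzD.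
  by have -> : (p + p * Posz m = p * Posz m.+1)%R by lia.
rewrite -(gle_mul2l y) !mulgA mulgV mul1g.
apply: (@gle_trans (D q * D p)); first by rewrite gle_mul2r.
by rewrite -expgzD GRing.addrC expgzD gle_mul2r.
Qed.

(** Such a prefix would, when [p < q], make [D (p + 1)] a prefix of [y] by
[rigid_gleX].  When [p = q], the power [y ^+ m] is itself [D (p * m)]. *)
Lemma rigid_expgz_ngleX y m :
  rigid S y -> ~ D (ginf S y * Posz m + 1)%R ≼ y ^+ m.
Proof.
move=> ry; case: m => [|m] DX.
  by move: DX; rewrite GRing.mulr0 => /(@expgz_gle _ 0%R).
have [[_ imax] [ys _]] := (ginfP y, gsupP y).
case: (boolP (ginf S y + 1 <= gsup S y)%R) => [/gle_expgz lt_is|ge_is].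
  suff /imax : D (ginf S y + 1)%R ≼ y by lia.
  apply: rigid_gleX (m) _ ry _ lt_is; rewrite -expgzD.
  by move: DX; congr (D _ ≼ _); lia.
have eq_is : gsup S y = ginf S y by have := ginf_le_gsup y; lia.
have /(gle_trans DX)/expgz_gle : y ^+ m.+1 ≼ D (ginf S y * Posz m.+1)%R.
  by rewrite -eq_is; exact: gleX_expgz.
by lia.
Qed.

(** Otherwise, writing [y ^+ m] as a conjugate of [(y ^ a) ^+ m], one finds
that its [inf] is at least [m * (p + 1)] up to an error independent of [m]. *)
Lemma rigid_ginf_max y a : rigid S y -> (ginf S (y ^ a) <= ginf S y)%R.
Proof.
move=> ry; case: (boolP (_ <= _)%R) => // lt_yz.
have [[n [na _]] [n' [na' _]]] := (expgz_bounds a, expgz_bounds a^-1).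
have Dz : D (ginf S y + 1)%R ≼ y ^ a.
  by apply: gle_trans (ginfP _).1; apply: gle_expgz; lia.
(* The error is n + n', so this exponent exceeds it by one. *)
case: (@rigid_expgz_ngleX y (n + n').+1 ry).
rewrite -[X in _ ≼ X ^+ _](conjgK a y) -conjXg [X in _ ≼ X]conjgE invgK.
have := expgz_gleM na (expgz_gleM (expgz_gleX (n + n').+1 Dz) na').
by congr (D _ ≼ _); lia.
Qed.

Lemma rigid_gsup_min y a : rigid S y -> (gsup S y <= gsup S (y ^ a))%R.
Proof.
by move=> /rigidV/(rigid_ginf_max a); rewrite conjVg !ginfV; lia.
Qed.

(** * Sliding towards a rigid element *)

(** The [inf] and [sup] of a rigid conjugate are separately extremal, so minimality
of their difference at [x] forces both equalities. *)
Lemma SSS_rigid_conj x a : SSS S x x -> rigid S (x ^ a) ->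
  ginf S x = ginf S (x ^ a) /\ gsup S x = gsup S (x ^ a).
Proof.
move=> [_ xmin] ra.
have /xmin : conj_class x (x ^ a) by exists a.
have := rigid_ginf_max a^-1 ra; have := rigid_gsup_min a^-1 ra.
by rewrite conjgK /canonical_length; lia.
Qed.

(** Sliding does not decrease [inf] nor increase [sup]. *)
Lemma cyclic_sliding_SSS x : SSS S x x ->
  SSS S (cyclic_sliding S x) (cyclic_sliding S x).
Proof.
move=> [_ xmin]; split; first by exists 1; rewrite ?conjg1.
move=> z [a _ <-]; rewrite /cyclic_sliding -conjgM.
have /xmin : conj_class x (x ^ (preferred_prefix S x * a)) by eexists.
have cP := preferred_prefix_pos x.
have [] := (gle_preferred_prefix _ x).1 (gle_refl _).
move: (preferred_prefix S x) cP => c cP ic sc _.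
have /(ginfP _).2 : D (ginf S x) ≼ x ^ c.
  by rewrite conjgE -(gle_mul2l c) mulVKg; apply: gle_trans ic _; rewrite gle_mulr.
have /(gsupP _).2 : x ^ c ≼ D (gsup S x).
  rewrite conjgE -(gle_mul2l c) mulVKg; apply: gle_trans sc _.
  by rewrite -{1}(mul1g (D _)) gle_mul2r gle1.
by rewrite /canonical_length; lia.
Qed.

(** Equivalently, the transport [(pp x)^-1 * a * pp (x ^ a)] of a positive
conjugator [a] is positive. *)
Lemma preferred_prefix_transport x a : P a ->
  ginf S x = ginf S (x ^ a) -> gsup S x = gsup S (x ^ a) ->
  preferred_prefix S x ≼ a * preferred_prefix S (x ^ a).
Proof.
move=> Pa ie se.
have [ic sc dc] := (gle_preferred_prefix _ x).1 (gle_refl _).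
have aD n : D n ≼ a * D n by rewrite -{1}(mul1g (D n)) gle_mul2r gle1.
rewrite -[X in X ≼ _](mulVKg a) gle_mul2l; apply/gle_preferred_prefix.
rewrite -ie -se -(gle_mul2l a) -(gle_mul2l a _ (D _)) -(gle_mul2l a _ (delta S)).
rewrite conjgE -!mulgA !mulVKg; split.
- by apply: gle_trans ic _; rewrite gle_mulr.
- exact: gle_trans sc _.
- exact: gle_trans dc (aD 1%R).
Qed.

Lemma SSS_preferred_prefix_gle x a : SSS S x x -> P a -> rigid S (x ^ a) ->
  preferred_prefix S x ≼ a.
Proof.
move=> xS Pa ra; have [ie se] := SSS_rigid_conj xS ra.
by have := preferred_prefix_transport Pa ie se; rewrite ra mulg1.
Qed.

Lemma sliding_conjugatorS k x : sliding_conjugator S k.+1 x =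
  preferred_prefix S x * sliding_conjugator S k (cyclic_sliding S x).
Proof.
rewrite /sliding_conjugator big_ord_recl; congr (_ * _).
by apply: eq_bigr => i _; rewrite -iterSr.
Qed.

Lemma sliding_conjugator_pos k x : P (sliding_conjugator S k x).
Proof.
elim: k x => [|k IHk] x; first by rewrite /sliding_conjugator big_ord0; exact: pos1.
by rewrite sliding_conjugatorS; apply: posM; [exact: preferred_prefix_pos|].
Qed.

Lemma conj_sliding_conjugator k x :
  x ^ sliding_conjugator S k x = iter k (cyclic_sliding S) x.
Proof.
elim: k x => [|k IHk] x; first by rewrite /sliding_conjugator big_ord0 conjg1.
by rewrite sliding_conjugatorS conjgM IHk iterSr.
Qed.

Lemma sliding_conjugator_gle k x a : SSS S x x -> P a -> rigid S (x ^ a) ->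
  sliding_conjugator S k x ≼ a.
Proof.
elim: k x a => [|k IHk] x a xS Pa ra.
  by rewrite /sliding_conjugator big_ord0 gle1.
rewrite sliding_conjugatorS -(mulVKg (preferred_prefix S x) a) gle_mul2l.
apply: IHk; first exact: cyclic_sliding_SSS.
- exact: SSS_preferred_prefix_gle.
- by rewrite /cyclic_sliding -conjgM mulVKg.
Qed.

(** Each nontrivial sliding step splits a factor off [a], which lowers the bound
on the lengths of its factorizations by one. *)
Lemma iter_sliding_rigid_bounded N x a : SSS S x x -> P a -> rigid S (x ^ a) ->
  (forall s : seq G, (forall b, b \in s -> P b /\ b <> 1) ->
     a = \prod_(b <- s) b -> (size s <= N)%N) ->
  exists k : nat, rigid S (iter k (cyclic_sliding S) x).
Proof.
elim: N x a => [|N IHN] x a xS Pa ra aN.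
  exists 0%N; move: ra; have [->|a1] := eqVneq a 1; first by rewrite conjg1.
  suff : (size [:: a] <= 0)%N by [].
  apply: aN; last by rewrite big_seq1.
  by move=> b; rewrite inE => /eqP ->; split=> //; exact/eqP.
have [rx|/eqP nrx] := eqVneq (preferred_prefix S x) 1; first by exists 0%N.
have [||||k rk] := IHN (cyclic_sliding S x) ((preferred_prefix S x)^-1 * a).
- exact: cyclic_sliding_SSS.
- exact: SSS_preferred_prefix_gle.
- by rewrite /cyclic_sliding -conjgM mulVKg.
- move=> s sP as_; rewrite -ltnS.
  apply: (aN (preferred_prefix S x :: s)); last by rewrite big_cons -as_ mulVKg.
  move=> b; rewrite inE => /orP[/eqP ->|/sP //].
  by split=> //; exact: preferred_prefix_pos.
by exists k.+1; rewrite iterSr.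
Qed.

Lemma iter_sliding_rigid x a : SSS S x x -> P a -> rigid S (x ^ a) ->
  exists k : nat, rigid S (iter k (cyclic_sliding S) x).
Proof.
move=> xS Pa; have [->|/eqP a1 ra] := eqVneq a 1.
  by rewrite conjg1 => rx; exists 0%N.
have [N aN] := pos_norm_finite Pa a1.
by apply: (iter_sliding_rigid_bounded (N := N) xS Pa ra) => s sP as_; apply: aN; exists s.
Qed.

(** A conjugator becomes positive after multiplication by a large power of Delta,
and conjugation by Delta preserves rigidity. *)
Lemma conj_class_rigid_pos x y : conj_class x y -> rigid S y ->
  exists a, P a /\ rigid S (x ^ a).
Proof.
move=> [a _ <-] ry; have [n [na _]] := expgz_bounds a; exists (a * D n); split.
  by rewrite -gle1 -(gle_mul2r (- Posz n)) -mulgA -expgzD GRing.subrr mul1g mulg1.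
by rewrite conjgM; exact: rigid_conj_expgz.
Qed.

End GarsideTheory.

Theorem theorem1p2 (G : groupType) (S : garside G) (hfin : finite_type S)
    (x : G) (hx : SSS S x x)
    (hrigid : exists y : G, conj_class x y /\ rigid S y) :
  (exists k : nat, rigid S (iter k (cyclic_sliding S) x)) /\
  (forall k : nat, rigid S (iter k (cyclic_sliding S) x) ->
    [/\ pos S (sliding_conjugator S k x),
        x ^ sliding_conjugator S k x = iter k (cyclic_sliding S) x
      & forall a : G, pos S a -> rigid S (x ^ a) ->
          gle S (sliding_conjugator S k x) a]).
Proof.
have [D1|/eqP D1] := eqVneq (delta S) 1.
  have G1 := trivial_delta D1; split; first by exists 0%N; exact: G1.
  move=> k _; split; first by rewrite (G1 (sliding_conjugator _ _ _)); exact: pos1.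
    by rewrite (G1 (x ^ _)) (G1 (iter _ _ _)).
  by move=> a _ _; rewrite (G1 (sliding_conjugator _ _ _)) (G1 a); exact: gle_refl.
have [y [xy ry]] := hrigid.
have [a [Pa ra]] := conj_class_rigid_pos D1 xy ry.
split; first exact: (iter_sliding_rigid D1 hx Pa ra).
move=> k _; split=> [||b]; first exact: sliding_conjugator_pos.
  exact: conj_sliding_conjugator.
exact: sliding_conjugator_gle.
Qed.
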